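(* Let $\mathcal{A}=(A_0,\ldots,A_{M-1})\in M_d(\mathbb{R})^M$ be primitive, i.e. there exist $N$ and $\delta>0$ such that $$\sum_{|K|=N}\|A_I A_K A_J\|\ \ge\ \delta\,\|A_I\|\,\|A_J\|$$ for all words $I,J$ over $\{0,\ldots,M-1\}$. Then for any $t>0$ the unique $t$-Gibbs state $\mu_{\mathcal{A},t}$ for $\mathcal{A}$ (the unique matrix Gibbs state for $(\mathcal{A},t)$) is weak Bernoulli.
   Context: Let $\Sigma=\{0,\ldots,M-1\}$ and let $\sigma$ be the left shift on the two-sided full shift $\Sigma^{\mathbb{Z}}$. For a word $I=i_0i_1\cdots i_{n-1}$ over $\Sigma$ write $|I|=n$ and $A_I=A_{i_0}A_{i_1}\cdots A_{i_{n-1}}$; the sum $\sum_{|K|=N}$ is over all words of length $N$. The cylinder is $[x_0\cdots x_{n-1}]=\{y\in\Sigma^{\mathbb{Z}}: y_i=x_i,\ 0\le i\le n-1\}$. Matrix Gibbs state: for $t>0$, a shift-invariant Borel probability measure $\mu$ on $\Sigma^{\mathbb{Z}}$ is a matrix Gibbs state for $(\mathcal{A},t)$ (a $t$-Gibbs state for $\mathcal{A}$) if there exist constants $C>0$ and $P\in\mathbb{R}$ such that $$C^{-1}\mu([x_0\cdots x_{n-1}])\le e^{-nP}\|A_{x_0}\cdots A_{x_{n-1}}\|^t\le C\,\mu([x_0\cdots x_{n-1}])$$ for all $x\in\Sigma^{\mathbb{Z}}$ and $n>0$. It is a known fact from the literature that for primitive collections (with not all matrices zero) and every $t>0$ such a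 measure exists and is unique; ''the unique $t$-Gibbs state'' refers to this measure. Weak Bernoulli: for finite measurable partitions $\mathcal{Q},\mathcal{R}$ and $\varepsilon>0$, write $\mathcal{Q}\perp^{\varepsilon}\mathcal{R}$ if $\sum_{q\in\mathcal{Q},r\in\mathcal{R}}|\mu(q\cap r)-\mu(q)\mu(r)|<\varepsilon$. A partition $\mathcal{P}$ is weak Bernoulli if for every $\varepsilon>0$ there is $N'$ such that $\bigvee_{i=0}^{s-1}\sigma^{-i}\mathcal{P}\perp^{\varepsilon}\bigvee_{i=m}^{m+r-1}\sigma^{-i}\mathcal{P}$ for all $r,s\ge 0$ and $m\ge s+N'$. The measure $\mu$ is weak Bernoulli if the standard partition $\mathcal{P}=\{[i]:0\le i\le M-1\}$ is weak Bernoulli. *)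

(* Defs.v *)
From HB Require Import structures.
From mathcomp Require Export all_boot all_order all_algebra.
From mathcomp Require Export all_classical all_reals all_analysis.

Set Implicit Arguments.
Unset Strict Implicit.
Unset Printing Implicit Defensive.
Import Order.TTheory GRing.Theory Num.Theory.
Import numFieldNormedType.Exports.
Local Open Scope classical_set_scope.
Local Open Scope ring_scope.

Definition is_norm (R : realType) (V : lmodType R) (nrm : V -> R) : Prop :=
  [/\ forall v, nrm v = 0 -> v = 0,
      forall (a : R) v, nrm (a *: v) = `|a| * nrm v
    & forall v w, nrm (v + w) <= nrm v + nrm w].

(* The alphabet has M.+1 letters: a full shift carrying a probability measure
   has a nonempty alphabet. *)
Definition full_shift (M : nat) : Type :=
  prod_topology (fun _ : int => discrete_topology 'I_M.+1).

HB.instance Definition _ (M : nat) := Topological.copy (full_shift M)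
  (prod_topology (fun _ : int => discrete_topology 'I_M.+1)).
HB.instance Definition _ (M : nat) :=
  isPointed.Build (full_shift M) (fun=> ord0).

Definition borel_shift (M : nat) : measurableType _ :=
  g_sigma_algebraType (@open (full_shift M)).

Definition shift (M : nat) (x : full_shift M) : full_shift M :=
  fun i => x (i + 1).

Definition initial_word (M : nat) (x : full_shift M) (n : nat) : seq 'I_M.+1 :=
  mkseq (fun i : nat => x i%:Z) n.

Definition cylinder (M : nat) (w : seq 'I_M.+1) : set (full_shift M) :=
  [set y | initial_word y (size w) = w].

Definition word_mx (R : realType) (d M : nat) (A : 'I_M.+1 -> 'M[R]_d)
    (w : seq 'I_M.+1) : 'M[R]_d :=
  \prod_(i <- w) A i.

Definition primitive (R : realType) (d M : nat) (nrm : 'M[R]_d -> R)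
    (A : 'I_M.+1 -> 'M[R]_d) : Prop :=
  exists (N : nat) (delta : R), 0 < delta /\
    forall I J : seq 'I_M.+1,
      \sum_(K : N.-tuple 'I_M.+1)
         nrm (word_mx A I * word_mx A K * word_mx A J)
      >= delta * nrm (word_mx A I) * nrm (word_mx A J).

Definition shift_invariant (R : realType) (M : nat)
    (mu : probability (borel_shift M) R) : Prop :=
  forall B : set (borel_shift M), measurable B -> mu (@shift M @^-1` B) = mu B.

Definition gibbs_state (R : realType) (d M : nat) (nrm : 'M[R]_d -> R)
    (A : 'I_M.+1 -> 'M[R]_d) (t : R)
    (mu : probability (borel_shift M) R) : Prop :=
  shift_invariant mu /\
  exists C P : R, 0 < C /\
    forall (x : full_shift M) (n : nat), (0 < n)%N ->
      let w := initial_word x n in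
      let a := expR (- (n%:R * P)) * nrm (word_mx A w) `^ t in
      ((C^-1)%:E * mu (cylinder w) <= a%:E)%E /\
      (a%:E <= C%:E * mu (cylinder w))%E.

(* A finite partition is given as a family of sets indexed by a finite type;
   empty members are allowed and contribute nothing to the sum. *)
Definition eps_independent (disp : measure_display) (T : measurableType disp)
    (R : realType) (mu : probability T R) (eps : R) (I J : finType)
    (Q : I -> set T) (S : J -> set T) : Prop :=
  (\sum_(i : I) \sum_(j : J)
     `|mu (Q i `&` S j) - mu (Q i) * mu (S j)| < eps%:E)%E.

(* The join of the partitions f^-i P for m <= i < m + r; for r = 0 this is the
   trivial partition, whose only member is the whole space. *)
Definition iter_join (T : Type) (f : T -> T) (I : finType) (P : I -> set T)
    (m r : nat) (c : {ffun 'I_r -> I}) : set T :=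
  \bigcap_(i in [set: 'I_r]) (iter (m + i) f @^-1` P (c i)).

Definition weak_bernoulli_partition (disp : measure_display)
    (T : measurableType disp) (R : realType) (mu : probability T R)
    (f : T -> T) (I : finType) (P : I -> set T) : Prop :=
  forall eps : R, 0 < eps -> exists N' : nat,
    forall r s m : nat, (s + N' <= m)%N ->
      eps_independent mu eps (@iter_join _ f _ P 0 s) (@iter_join _ f _ P m r).

Definition standard_partition (M : nat) (i : 'I_M.+1) : set (full_shift M) :=
  cylinder [:: i].

Definition weak_bernoulli (R : realType) (M : nat)
    (mu : probability (borel_shift M) R) : Prop :=
  weak_bernoulli_partition mu (@shift M) (@standard_partition M).

(* Main.v *)
From mathcomp Require Import ring lra.
Require Import Defs.
Set Implicit Arguments.
Unset Strict Implicit.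
Unset Printing Implicit Defensive.
Import Order.TTheory GRing.Theory Num.Theory.
Import numFieldNormedType.Exports.
Local Open Scope classical_set_scope.
Local Open Scope ring_scope.

(** Write [p w] for the mass of the cylinder of [w].  By invariance, [p] is a
nonnegative function on words, with [p [::] = 1], such that summing over all
extensions of fixed length of a word, on either side, gives back its mass.
For two words [I] and [J] separated by a gap of length [g] let
[gap_prob g I J] be the mass of the set of sequences that read [I], then [g]
free letters, then [J].  Two features of a Gibbs state are used:
for all large [g], and with constants [0 < c] and [C] independent of [g],
  [c * (p I * p J) <= gap_prob g I J <= C * (p I * p J)].
The upper bound ([gibbs_gap_upper]) holds because a norm on a
finite-dimensional matrix algebra is submultiplicative up to a constant; the
lower one ([gibbs_gap_lower]) holds because primitivity provides a
connecting word [K] of fixed length with [A_I A_K A_J] not much smaller than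
[A_I] times [A_J] in norm.

From these bounds alone the weak Bernoulli property follows
([gap_prob_weak_bernoulli]).  Let [excess g I J] be the density of the joint
law of the two words with respect to the product law, minus one, and let
[chi2 s g r] be its squared L2 norm for words of lengths [s] and [r]: the
chi-squared divergence from independence.  It is bounded, thanks to the upper
bound.  Passing to a subword amounts to a conditional expectation, so [chi2]
grows with the windows and, as shortening the second word from the left
widens the gap, its supremum over [s] and [r] decreases with [g].  Let [v]
be the limit.  Take two windows of the future, the second starting after the
end of the first plus a gap [h], with the same past [I] and with [chi2]
close to [v] for both.  Both excesses are conditional expectations of the
excess of one large window, whose [chi2] is close to [v] as well, so by
Pythagoras both are L2-close to it, hence to each other.  On the other hand
the law of the two windows dominates [c] times the product of their laws, and
under the product law two independent centred variables are at squared distance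
the sum of their variances, about [2 * v].  This forces [v = 0]
([chi2_two_windows], [chi2_vanishes]), and the L1 distance in the definition
of weak Bernoulli is controlled by the L2 distance. *)

(** * Norms on finite-dimensional spaces *)

Section Norms.
Context {R : realType}.

Section Basic.
Context {V : lmodType R} {nrm : V -> R} (hn : is_norm nrm).

Lemma is_norm0 : nrm 0 = 0.
Proof. by case: hn => _ hZ _; rewrite -(scale0r 0) hZ normr0 mul0r. Qed.

Lemma is_normN v : nrm (- v) = nrm v.
Proof. by case: hn => _ hZ _; rewrite -scaleN1r hZ normrN1 mul1r. Qed.

Lemma is_norm_ge0 v : 0 <= nrm v.
Proof.
case: hn => _ _ /(_ v (- v)).
by rewrite subrr is_norm0 is_normN -mulr2n pmulrn_lge0.
Qed.

Lemma is_norm_sum (I : Type) (r : seq I) (F : I -> V) :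
  nrm (\sum_(i <- r) F i) <= \sum_(i <- r) nrm (F i).
Proof.
case: hn => _ _ hD.
elim/big_ind2: _ => [|x1 x2 y1 y2 h1 h2|//]; first by rewrite is_norm0.
exact: le_trans (hD _ _) (lerD h1 h2).
Qed.

Lemma is_norm_dist v w : `|nrm v - nrm w| <= nrm (v - w).
Proof.
have hd x y : nrm x - nrm y <= nrm (x - y).
  by case: hn => _ _ hD; rewrite lerBlDr (le_trans _ (hD _ _))// subrK.
by rewrite ler_norml lerNl opprB hd andbT -(is_normN (v - w)) opprB hd.
Qed.
End Basic.

Section RowVectors.
Context {n : nat} {nrm : 'rV[R]_n -> R} (hn : is_norm nrm).

(** Expand [v] in the standard basis. *)
Lemma rV_norm_upper : exists2 K : R, 0 < K & forall v, nrm v <= K * `|v|.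
Proof.
exists (1 + \sum_j nrm (delta_mx 0 j)).
  by rewrite ltr_pwDl// sumr_ge0// => j _; exact: is_norm_ge0.
move=> v; rewrite [in leLHS](row_sum_delta v).
rewrite (le_trans (is_norm_sum hn _ _))// mulrDl mul1r.
rewrite (@le_trans _ _ (\sum_j nrm (delta_mx 0 j) * `|v|)) -?mulr_suml ?lerDr//.
rewrite mulr_suml; apply: ler_sum => j _; case: hn => _ -> _.
rewrite mulrC ler_wpM2l ?is_norm_ge0//.
rewrite {2}/Num.norm/= mx_normE.
exact: (le_bigmax _ (fun i : 'I_1 * 'I_n => `|v i.1 i.2|%:nng) (0, j)).
Qed.

Lemma rV_norm_continuous : continuous nrm.
Proof.
have [K K0 hK] := rV_norm_upper.
move=> v; apply/(@cvgrPdist_le _ _ _ _ (nbhs_filter (v : 'rV[R]_n))) => e e0.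
have := @nbhsx_ballx R _ (v : 'rV[R]_n) (e / K) (divr_gt0 e0 K0).
apply: filterS => w; rewrite -ball_normE/= => vw.
apply: le_trans (is_norm_dist hn _ _) _.
by apply: le_trans (hK _) _; rewrite mulrC -ler_pdivlMr// ltW.
Qed.

(** The continuous function [nrm] attains its minimum on the unit sphere of the
sup norm, which is compact, and the minimum is nonzero there. *)
Lemma rV_norm_lower : exists2 k : R, 0 < k & forall v, k * `|v| <= nrm v.
Proof.
pose S := [set v : 'rV[R]_n | `|v| = 1].
have Sc : compact S.
  apply: bounded_closed_compact.
    by exists 1; split => [//|x x1 v /= ->]; exact: ltW.
  apply: (@closed_comp _ _ (fun v : 'rV[R]_n => `|v|) [set 1 : R]).
    by move=> v _; exact: norm_continuous.
  exact: closed_eq.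
have [S0|/set0P/negP/negPn/eqP S0] := pselect (S !=set0); last first.
  exists 1 => // v; have [->|v0] := eqVneq v 0.
    by rewrite normr0 mulr0 is_norm0.
  suff : S (`|v|^-1 *: v) by rewrite S0.
  by rewrite /S/= normrZ normfV normr_id mulVf// normr_eq0.
have [c cS hc] := @EVT_min_rV R n nrm S S0 Sc
  (@continuous_subspaceT _ _ _ _ rV_norm_continuous).
have c0 : 0 < nrm c.
  rewrite lt_neqAle is_norm_ge0// andbT; apply/eqP => /esym.
  case: hn => h _ _ /h ce; move: cS; rewrite inE /S/= ce normr0 => /esym/eqP.
  by rewrite oner_eq0.
exists (nrm c) => // v; have [->|v0] := eqVneq v 0.
  by rewrite normr0 mulr0 is_norm0.
have v1 : `|v| != 0 by rewrite normr_eq0.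
have := hc (`|v|^-1 *: v).
rewrite inE /S/= normrZ normfV normr_id mulVf// => /(_ erefl).
case: hn => _ -> _; rewrite normfV normr_id mulrC ler_pdivlMr//.
by rewrite normr_gt0.
Qed.
End RowVectors.

(** The bound holds for the sup norm of the entries with constant [d], and any
norm is equivalent to the sup norm. *)
Lemma mx_norm_submultiplicative (d : nat) (nrm : 'M[R]_d -> R) :
  is_norm nrm ->
  exists2 K : R, 0 < K & forall A B, nrm (A *m B) <= K * (nrm A * nrm B).
Proof.
move=> hn.
pose nv (v : 'rV[R]_(d * d)) := nrm (vec_mx v).
have hv : is_norm nv.
  case: hn => h1 h2 h3; split; rewrite /nv.
  - move=> v /h1 v0; apply: (can_inj vec_mxK); by rewrite v0 linear0.
  - by move=> a v; rewrite linearZ/= h2.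
  - by move=> v w; rewrite linearD/= h3.
have [K1 K10 h1] := rV_norm_upper hv.
have [k k0 h2] := rV_norm_lower hv.
have ent (A : 'M[R]_d) i j : `|A i j| <= k^-1 * nrm A.
  rewrite mulrC ler_pdivlMr// mulrC -[A in nrm A]mxvecK.
  apply: le_trans (h2 _); rewrite ler_pM2l// -(mxvecE A i j).
  rewrite [in leRHS]/Num.norm/= mx_normE.
  exact: (le_bigmax _ (fun i : 'I_1 * _ => `|mxvec A i.1 i.2|%:nng)
    (0, mxvec_index i j)).
exists (1 + K1 * (d%:R * (k^-1 * k^-1))).
  by rewrite ltr_pwDl// !mulr_ge0// ?invr_ge0 ltW.
move=> A B.
have AB0 : 0 <= nrm A * nrm B by rewrite mulr_ge0// is_norm_ge0.
rewrite mulrDl mul1r ler_wpDl// -mulrA -[A *m B]mxvecK.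
apply: le_trans (h1 _) _; rewrite ler_pM2l//.
rewrite [in leLHS]/Num.norm/= mx_normE.
have c0 : 0 <= d%:R * (k^-1 / k) * (nrm A * nrm B).
  by rewrite mulr_ge0// mulr_ge0// mulr_ge0// invr_ge0 ltW.
rewrite -[leRHS]/((NngNum c0)%:num) num_le; apply/bigmax_leP; split=> // -[i j] _.
rewrite -num_le/= ord1; case/mxvec_indexP: j => i' j'.
rewrite mxvecE mxE (le_trans (ler_norm_sum _ _ _))//.
rewrite (@le_trans _ _ (\sum_(l < d) (k^-1 / k) * (nrm A * nrm B)))//.
  apply: ler_sum => l _; rewrite normrM mulrACA.
  by apply: ler_pM => //; exact: ent.
by rewrite sumr_const card_ord -[leLHS]mulr_natl !mulrA.
Qed.

End Norms.

(** * Words of a given length *)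

Section Words.
Context {T : finType}.

Definition words (n : nat) : seq (seq T) := [seq val t | t : n.-tuple T].

Lemma mem_words n w : (w \in words n) = (size w == n).
Proof.
apply/mapP/eqP => [[t _ ->]|wn]; first exact: size_tuple.
by move/eqP: wn => wn; exists (Tuple wn); rewrite ?mem_enum.
Qed.

Lemma words_uniq n : uniq (words n).
Proof. by rewrite map_inj_uniq ?enum_uniq//; exact: val_inj. Qed.

Lemma sum_words_tuple (V : nmodType) n (F : seq T -> V) :
  \sum_(w <- words n) F w = \sum_(t : n.-tuple T) F t.
Proof. by rewrite big_map big_enum. Qed.

Lemma sum_words_cat (V : nmodType) m n (F : seq T -> V) :
  \sum_(w <- words (m + n)) F w =
  \sum_(u <- words m) \sum_(v <- words n) F (u ++ v).
Proof.
rewrite -(@big_allpairs_dep _ _ _ _ _ _ (fun u v => u ++ v) _ (fun=> words n)).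
apply: perm_big; apply: uniq_perm; first exact: words_uniq.
  apply: allpairs_uniq; rewrite ?words_uniq// => -[u v] [u' v'] /=.
  move=> /allpairsP[[a b]/= [+ _ [-> _]]] /allpairsP[[a' b']/= [+ _ [-> _]]].
  rewrite !mem_words => /eqP sa /eqP sa' /eqP; rewrite eqseq_cat ?sa//.
  by move=> /andP[/eqP-> /eqP->].
move=> w; rewrite mem_words; apply/eqP/allpairsP => [wmn|[[u v]/= [+ + ->]]].
  exists (take m w, drop m w); rewrite /= cat_take_drop !mem_words.
  rewrite size_drop wmn addKn eqxx size_take wmn; split=> //.
  by case: n {wmn} => [|n]; rewrite ?addn0 ?ltnn// -ltn_subLR// subnn.
by rewrite !mem_words size_cat => /eqP-> /eqP->.
Qed.
End Words.

(** * Independence of distant words *)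

Section WeightedMean.
Context {R : realType} {X : Type}.

(** Pythagoras for a conditional expectation: [a] is the mean of [f] on a fibre
of mass [m], so the squared distance from [f] to [a] is the loss of second
moment. *)
Lemma weighted_variance (r : seq X) (q f : X -> R) (m a : R) :
  \sum_(x <- r) q x = m -> \sum_(x <- r) q x * f x = m * a ->
  \sum_(x <- r) q x * (f x - a) ^+ 2 = \sum_(x <- r) q x * f x ^+ 2 - m * a ^+ 2.
Proof.
move=> qm qfm.
rewrite (eq_bigr (fun x => q x * f x ^+ 2 + (- (2 * a)) * (q x * f x)
  + a ^+ 2 * q x)); last by move=> x _; ring.
by rewrite !big_split/= -!mulr_sumr qm qfm; ring.
Qed.
End WeightedMean.

Section Process.
Context {R : realType} {T : finType} {p : seq T -> R}.
Hypothesis p_ge0 : forall w, 0 <= p w.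
Hypothesis p_nil : p [::] = 1.
Hypothesis p_catr : forall w n, \sum_(u <- words n) p (w ++ u) = p w.
Hypothesis p_catl : forall w n, \sum_(u <- words n) p (u ++ w) = p w.

Definition gap_prob g (I J : seq T) := \sum_(K <- words g) p (I ++ K ++ J).

(** The junk value of the division at [p I * p J = 0] is harmless: the density
is always weighted by [p I * p J]. *)
Definition excess g I J := gap_prob g I J / (p I * p J) - 1.

Definition chi2 s g r := \sum_(I <- words s) \sum_(J <- words r)
  p I * p J * excess g I J ^+ 2.

Lemma p_total n : \sum_(u <- words n) p u = 1.
Proof. by rewrite -p_nil -[RHS](p_catr _ n). Qed.

Lemma gap_prob_nil g I : gap_prob g I [::] = p I.
Proof. by rewrite -[RHS](p_catr _ g); apply: eq_bigr => K _; rewrite cats0. Qed.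

Lemma gap_prob_nill g J : gap_prob g [::] J = p J.
Proof. exact: p_catl. Qed.

Lemma gap_prob_ge0 g I J : 0 <= gap_prob g I J.
Proof. by apply: sumr_ge0 => K _; exact: p_ge0. Qed.

Lemma gap_prob_extr g I J n :
  \sum_(K <- words n) gap_prob g I (J ++ K) = gap_prob g I J.
Proof.
rewrite exchange_big; apply: eq_bigr => L _ /=.
by rewrite -(p_catr (I ++ L ++ J) n); apply: eq_bigr => K _; rewrite !catA.
Qed.

Lemma gap_prob_extl g I J n :
  \sum_(K <- words n) gap_prob g (K ++ I) J = gap_prob g I J.
Proof.
rewrite exchange_big; apply: eq_bigr => L _ /=.
by rewrite -(p_catl (I ++ L ++ J) n); apply: eq_bigr => K _; rewrite !catA.
Qed.

Lemma gap_prob_extm g I J n :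
  \sum_(K <- words n) gap_prob g I (K ++ J) = gap_prob (g + n) I J.
Proof.
rewrite exchange_big /gap_prob sum_words_cat; apply: eq_bigr => L _ /=.
by apply: eq_bigr => K _; rewrite !catA.
Qed.

Context {N : nat} {c C : R}.
Hypothesis c_gt0 : 0 < c.
Hypothesis gap_lower : forall g I J, (N <= g)%N ->
  c * (p I * p J) <= gap_prob g I J.
Hypothesis gap_upper : forall g I J, (N <= g)%N ->
  gap_prob g I J <= C * (p I * p J).

Lemma excessE g I J : (N <= g)%N ->
  p I * p J * excess g I J = gap_prob g I J - p I * p J.
Proof.
move=> Ng; have [pp0|pp0] := eqVneq (p I * p J) 0.
  have := gap_upper I J Ng; rewrite pp0 mulr0 mul0r subr0 => le0.
  by apply/eqP; rewrite eq_le gap_prob_ge0 le0.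
by rewrite /excess mulrBr mulr1 mulrC divfK.
Qed.

(** The next three lemmas say that the excess of a pair of words is the
conditional expectation, under the product law, of the excess of longer words:
the second one extended to the right, the first one to the left, or the second
one to the left. The last extension eats into the gap. *)
Lemma excess_extr g I J n : (N <= g)%N ->
  \sum_(K <- words n) p I * p (J ++ K) * excess g I (J ++ K)
  = p I * p J * excess g I J.
Proof.
move=> Ng; under eq_bigr do rewrite excessE//.
by rewrite sumrB gap_prob_extr -mulr_sumr p_catr excessE.
Qed.

Lemma excess_extl g I J n : (N <= g)%N ->
  \sum_(K <- words n) p (K ++ I) * p J * excess g (K ++ I) J
  = p I * p J * excess g I J.
Proof.
move=> Ng; under eq_bigr do rewrite excessE//.
by rewrite sumrB gap_prob_extl -mulr_suml p_catl excessE.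
Qed.

Lemma excess_extm g I J n : (N <= g)%N ->
  \sum_(K <- words n) p I * p (K ++ J) * excess g I (K ++ J)
  = p I * p J * excess (g + n) I J.
Proof.
move=> Ng; under eq_bigr do rewrite excessE//.
rewrite sumrB gap_prob_extm -mulr_sumr p_catl excessE//.
by rewrite (leq_trans Ng)// leq_addr.
Qed.

Lemma excess_mean0 g I n : (N <= g)%N ->
  \sum_(J <- words n) p I * p J * excess g I J = 0.
Proof.
move=> Ng; rewrite (excess_extr I [::])// excessE// gap_prob_nil p_nil.
by rewrite mulr1 subrr.
Qed.

Lemma chi2_refine_future s g r n : (N <= g)%N ->
  \sum_(I <- words s) \sum_(J <- words r) \sum_(K <- words n)
    p I * p (J ++ K) * (excess g I (J ++ K) - excess g I J) ^+ 2
  = chi2 s g (r + n) - chi2 s g r.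
Proof.
move=> Ng; rewrite /chi2 -sumrB; apply: eq_bigr => I _.
rewrite sum_words_cat -sumrB; apply: eq_bigr => J _.
by apply: weighted_variance; rewrite ?excess_extr// -mulr_sumr p_catr.
Qed.

Lemma chi2_refine_gap s g r n : (N <= g)%N ->
  \sum_(I <- words s) \sum_(J <- words r) \sum_(K <- words n)
    p I * p (K ++ J) * (excess g I (K ++ J) - excess (g + n) I J) ^+ 2
  = chi2 s g (n + r) - chi2 s (g + n) r.
Proof.
move=> Ng; rewrite /chi2 -sumrB; apply: eq_bigr => I _.
rewrite sum_words_cat [X in _ = X - _]exchange_big -sumrB; apply: eq_bigr => J _.
by apply: weighted_variance; rewrite ?excess_extm// -mulr_sumr p_catl.
Qed.

Lemma chi2_past_le s g r n : (N <= g)%N -> chi2 s g r <= chi2 (n + s) g r.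
Proof.
move=> Ng; rewrite -subr_ge0 /chi2 sum_words_cat [X in X - _]exchange_big -sumrB.
apply: sumr_ge0 => I _.
rewrite [X in X - _]exchange_big -sumrB; apply: sumr_ge0 => J _.
rewrite -(@weighted_variance _ _ _ (fun K => p (K ++ I) * p J)).
- by apply: sumr_ge0 => K _; rewrite mulr_ge0 ?sqr_ge0 ?mulr_ge0.
- by rewrite -mulr_suml p_catl.
- exact: excess_extl.
Qed.

Lemma chi2_gap_le s g r n : (N <= g)%N -> chi2 s (g + n) r <= chi2 s g (n + r).
Proof.
move=> Ng; rewrite -subr_ge0 -chi2_refine_gap//.
by do 3! apply: sumr_ge0 => ? _; rewrite mulr_ge0 ?sqr_ge0 ?mulr_ge0.
Qed.

Lemma chi2_bounded s g r : (N <= g)%N -> chi2 s g r <= (C + 1) ^+ 2.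
Proof.
move=> Ng.
rewrite (_ : _ ^+ 2 = \sum_(I <- words s) \sum_(J <- words r)
  p I * p J * (C + 1) ^+ 2); last first.
  under eq_bigr do rewrite -mulr_suml -mulr_sumr.
  by rewrite -mulr_suml -mulr_suml !p_total !mul1r.
apply: ler_sum => I _; apply: ler_sum => J _.
have pp_ge0 : 0 <= p I * p J by rewrite mulr_ge0.
have [->|pp0] := eqVneq (p I * p J) 0; first by rewrite !mul0r.
have pp_gt0 : 0 < p I * p J by rewrite lt_def pp0.
rewrite ler_wpM2l//.
have h1 : 0 <= gap_prob g I J / (p I * p J) by rewrite divr_ge0// gap_prob_ge0.
have h2 : gap_prob g I J / (p I * p J) <= C by rewrite ler_pdivrMr// gap_upper.
by rewrite /excess; nra.
Qed.

(** The words [J1] and [J2] are a prefix and a suffix of [J1 ++ G ++ J2], with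
[G] of length [h]. The right-hand side bounds the squared distance of their
excesses under [p I * p (J1 ++ G ++ J2)], through the excess of the long word.
The left-hand side is its lower bound after summation over [G], which replaces
[p (J1 ++ G ++ J2)] by [gap_prob h J1 J2 >= c * (p J1 * p J2)]; the cross
term then vanishes because the excess has mean zero. *)
Lemma chi2_two_windows s g r1 r2 h : (N <= g)%N -> (N <= h)%N ->
  c * (chi2 s g r1 + chi2 s (g + (r1 + h)) r2) <=
  2 * ((chi2 s g (r1 + (h + r2)) - chi2 s g r1) +
       (chi2 s g (r1 + (h + r2)) - chi2 s (g + (r1 + h)) r2)).
Proof.
move=> Ng Nh; set g2 := (g + (r1 + h))%N.
have Ng2 : (N <= g2)%N by rewrite (leq_trans Ng)// leq_addr.
rewrite -chi2_refine_future// addnA -chi2_refine_gap// -big_split mulr_sumr /=.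
rewrite /chi2 -big_split mulr_sumr; apply: ler_sum => I _ /=.
pose q1 J := excess g I J; pose q2 J := excess g2 I J.
have -> : \sum_(J <- words r1) p I * p J * excess g I J ^+ 2 +
          \sum_(J <- words r2) p I * p J * excess g2 I J ^+ 2 =
    \sum_(J1 <- words r1) \sum_(J2 <- words r2)
      p I * (p J1 * p J2) * (q1 J1 - q2 J2) ^+ 2.
  transitivity (\sum_(J1 <- words r1) \sum_(J2 <- words r2)
     ((p I * p J1 * q1 J1 ^+ 2) * p J2 + p J1 * (p I * p J2 * q2 J2 ^+ 2)
      + (p I * p J1 * q1 J1) * (- 2 * p J2 * q2 J2))); last first.
    by do 2! apply: eq_bigr => ? _; ring.
  apply: esym; under eq_bigr do rewrite !big_split/= -!mulr_sumr p_total mulr1.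
  by rewrite !big_split/= -!mulr_suml p_total mul1r excess_mean0// mul0r addr0.
have -> : \sum_(J <- words r1) \sum_(K <- words (h + r2))
    p I * p (J ++ K) * (excess g I (J ++ K) - excess g I J) ^+ 2 =
  \sum_(J1 <- words r1) \sum_(J2 <- words r2) \sum_(G <- words h)
    p I * p (J1 ++ G ++ J2) * (excess g I (J1 ++ G ++ J2) - q1 J1) ^+ 2.
  by apply: eq_bigr => J1 _; rewrite sum_words_cat exchange_big.
have -> : \sum_(J <- words r2) \sum_(K <- words (r1 + h))
    p I * p (K ++ J) * (excess g I (K ++ J) - excess g2 I J) ^+ 2 =
  \sum_(J1 <- words r1) \sum_(J2 <- words r2) \sum_(G <- words h)
    p I * p (J1 ++ G ++ J2) * (excess g I (J1 ++ G ++ J2) - q2 J2) ^+ 2.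
  rewrite [RHS]exchange_big; apply: eq_bigr => J2 _; rewrite sum_words_cat.
  by apply: eq_bigr => J1 _; apply: eq_bigr => G _; rewrite -catA.
rewrite -big_split !mulr_sumr; apply: ler_sum => J1 _ /=.
rewrite -big_split !mulr_sumr; apply: ler_sum => J2 _ /=.
rewrite -big_split mulr_sumr.
apply: (@le_trans _ _ (p I * gap_prob h J1 J2 * (q1 J1 - q2 J2) ^+ 2)).
  rewrite mulrA ler_wpM2r ?sqr_ge0// mulrCA ler_wpM2l//.
  exact: gap_lower.
rewrite /gap_prob mulr_sumr mulr_suml; apply: ler_sum => G _ /=.
rewrite -mulrDr [leRHS]mulrCA ler_wpM2l ?mulr_ge0//.
set f := excess g I _.
have := sqr_ge0 ((f - q1 J1) + (f - q2 J2)); nra.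
Qed.

(** The infimum [v] of the bounds [x] that hold for all window lengths at some gap
[G] is the limit of the suprema of [chi2], without mentioning the suprema. *)
Lemma chi2_vanishes (eps : R) : 0 < eps ->
  exists2 G, (N <= G)%N & forall s g r, (G <= g)%N -> chi2 s g r <= eps.
Proof.
move=> eps0.
pose U := [set x | exists2 G, (N <= G)%N & forall s r, chi2 s G r <= x].
have U0 : U !=set0.
  by exists ((C + 1) ^+ 2); exists N => // s r; exact: chi2_bounded.
have lbU : lbound U 0.
  move=> x [G NG /(_ 0%N 0%N)]; apply: le_trans.
  by do 2! apply: sumr_ge0 => ? _; rewrite mulr_ge0 ?sqr_ge0 ?mulr_ge0.
have infU : has_inf U by split=> //; exists 0.
set v := inf U.
have v_ge0 : 0 <= v by exact: lb_le_inf.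
have v_lt G e : (N <= G)%N -> 0 < e -> exists s r, v - e < chi2 s G r.
  move=> NG e0; apply: contrapT => nsr.
  suff : v <= v - e by lra.
  apply: ge_inf; first by exists 0.
  exists G => // s r; rewrite leNgt; apply/negP => lt.
  by apply: nsr; exists s, r.
have v_eq0 : v <= 0.
  apply/ler_addgt0Pr => e e0; rewrite add0r.
  pose e1 := e * c / (4 + c).
  have e10 : 0 < e1 by rewrite divr_gt0// ?mulr_gt0// addr_gt0.
  (* The slack is chosen so that [c * (2 * v - 2 * e1) <= 8 * e1] gives
     [v <= e]. *)
  have [x [G NG Gx] xv] := inf_adherent e10 infU.
  have [s1 [r1 h1]] := v_lt _ _ NG e10.
  have NG2 : (N <= G + (r1 + N))%N by rewrite (leq_trans NG)// leq_addr.
  have [s2 [r2 h2]] := v_lt _ _ NG2 e10.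
  (* A past of length [s1 + s2] contains both pasts, and [chi2] grows with it. *)
  have := chi2_two_windows (s1 + s2) r1 r2 NG (leqnn N).
  have := Gx (s1 + s2)%N (r1 + (N + r2))%N.
  have := chi2_past_le s1 r1 s2 NG; rewrite addnC.
  have := chi2_past_le s2 r2 s1 NG2.
  move: h1 h2 xv; rewrite -/v.
  set V1 := chi2 (s1 + s2) G r1; set V2 := chi2 (s1 + s2) (G + (r1 + N)) r2.
  set VB := chi2 _ _ (r1 + (N + r2)) => h1 h2 xv l2 l1 lB key.
  have e1E : e1 * (4 + c) = e * c by rewrite /e1 divfK// gt_eqF// addr_gt0.
  have k1 : c * (2 * v - 2 * e1) <= 8 * e1.
    apply: (@le_trans _ _ (c * (V1 + V2))); last by lra.
    by rewrite ler_pM2l//; lra.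
  rewrite -(ler_pM2l c_gt0); lra.
have [x [G NG Gx] xv] := inf_adherent eps0 infU.
exists G => // s g r /subnKC <-.
apply: le_trans (chi2_gap_le _ _ _ NG) _.
apply: le_trans (Gx _ _) _; rewrite -/v in xv; lra.
Qed.

(** Cauchy-Schwarz, in the form [2 * |a| <= eta + a ^ 2 / eta]. *)
Theorem gap_prob_weak_bernoulli (eps : R) : 0 < eps ->
  exists G, forall s g r, (G <= g)%N ->
    \sum_(I <- words s) \sum_(J <- words r) `|gap_prob g I J - p I * p J| < eps.
Proof.
move=> eps0.
pose eta := eps / 2; have eta0 : 0 < eta by rewrite divr_gt0.
have eta20 : 0 < eta ^+ 2 by rewrite exprn_gt0.
have [G NG hG] := chi2_vanishes eta20.
exists G => s g r Gg; have Ng := leq_trans NG Gg.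
apply: le_lt_trans (_ : eta < eps); last by rewrite /eta; lra.
apply: (@le_trans _ _ (eta / 2 + (2 * eta)^-1 * chi2 s g r)); last first.
  have {3}-> : eta = eta / 2 + (2 * eta)^-1 * eta ^+ 2 by field; rewrite gt_eqF.
  by rewrite lerD2l ler_pM2l ?hG// invr_gt0 mulr_gt0.
have -> : eta / 2 = \sum_(I <- words s) \sum_(J <- words r) p I * p J * (eta / 2).
  under eq_bigr do rewrite -mulr_suml -mulr_sumr.
  by rewrite -mulr_suml -mulr_suml !p_total !mul1r.
rewrite /chi2 mulr_sumr -big_split; apply: ler_sum => I _ /=.
rewrite mulr_sumr -big_split; apply: ler_sum => J _ /=.
rewrite -excessE// normrM ger0_norm ?mulr_ge0// (mulrCA (2 * eta)^-1) -mulrDr.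
rewrite ler_wpM2l ?mulr_ge0//; set f := excess _ _ _.
rewrite -(real_normK (num_real f)); set a := `|f|.
rewrite -subr_ge0 (_ : _ - _ = (2 * eta)^-1 * (a - eta) ^+ 2).
  by rewrite mulr_ge0 ?sqr_ge0// invr_ge0 mulr_ge0// ltW.
by field; rewrite gt_eqF.
Qed.

End Process.

(** * Cylinders and shift-invariant measures *)

Section Shift.
Context {M : nat}.
Local Notation T := 'I_M.+1.
Local Notation X := (borel_shift M).

Lemma iter_shiftE a (y : full_shift M) (i : int) :
  iter a (@shift M) y i = y (i + a%:Z).
Proof.
elim: a i => [|a IH] i /=; first by rewrite addr0.
by rewrite /shift IH -addrA -PoszD add1n.
Qed.

Lemma initial_word_cat (y : full_shift M) m n :
  initial_word y (m + n) =
  initial_word y m ++ initial_word (iter m (@shift M) y) n.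
Proof.
rewrite /initial_word /mkseq iotaD map_cat; congr (_ ++ _).
rewrite add0n -[m in iota m]addn0 iotaDl -map_comp; apply: eq_map => i /=.
by rewrite iter_shiftE addnC PoszD.
Qed.

Lemma size_initial_word (y : full_shift M) n : size (initial_word y n) = n.
Proof. exact: size_mkseq. Qed.

Lemma cylinder_nil : cylinder [::] = [set: full_shift M].
Proof. by apply/seteqP; split. Qed.

Lemma cylinder_cat (u v : seq T) :
  cylinder (u ++ v) = cylinder u `&` iter (size u) (@shift M) @^-1` cylinder v.
Proof.
apply/seteqP; split => y; rewrite /cylinder/= size_cat initial_word_cat.
  move/eqP; rewrite eqseq_cat ?size_initial_word//.
  by move=> /andP[/eqP-> /eqP->].
by move=> [-> ->].
Qed.

Lemma preimage_shift_cylinder1 a (x : T) :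
  iter a (@shift M) @^-1` cylinder [:: x] = [set y | y a%:Z = x].
Proof.
apply/seteqP; split => y; rewrite /cylinder /initial_word /mkseq/=.
  by case; rewrite iter_shiftE add0r.
by move=> <-; rewrite iter_shiftE add0r.
Qed.

Lemma preimage_shift_cylinder1_open a (x : T) :
  open (iter a (@shift M) @^-1` cylinder [:: x]).
Proof.
rewrite preimage_shift_cylinder1.
apply: (@open_comp (full_shift M) (discrete_topology T) (fun y => y a%:Z) [set x]).
  by move=> y _; exact: (@proj_continuous int (fun=> discrete_topology T)).
exact: discrete_open.
Qed.

Lemma measurable_preimage_shift_cylinder a (w : seq T) :
  measurable (iter a (@shift M) @^-1` cylinder w : set X).
Proof.
elim: w a => [|x w IH] a.
  by rewrite cylinder_nil preimage_setT; exact: measurableT.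
rewrite -cat1s cylinder_cat preimage_setI; apply: measurableI.
  by apply: sub_sigma_algebra; exact: preimage_shift_cylinder1_open.
exact: (IH a.+1).
Qed.

Lemma measurable_cylinder (w : seq T) : measurable (cylinder w : set X).
Proof. exact: (measurable_preimage_shift_cylinder 0). Qed.

Lemma iter_join_cylinder m r (f : {ffun 'I_r -> T}) :
  iter_join (@shift M) (@standard_partition M) m f =
  iter m (@shift M) @^-1` cylinder (codom f).
Proof.
have nth_f (i : 'I_r) : nth ord0 (codom f) i = f i.
  by rewrite codomE (nth_map i) ?size_enum_ord// nth_ord_enum.
apply/seteqP; split => y /=; rewrite /cylinder/= size_codom card_ord.
  move=> h.
  apply: (@eq_from_nth _ ord0); first by rewrite size_initial_word size_codom card_ord.
  rewrite size_initial_word => i ir; rewrite nth_mkseq//.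
  have := h (Ordinal ir) I.
  rewrite /standard_partition -/((_ @^-1` _) y) preimage_shift_cylinder1/= => yf.
  by rewrite (nth_f (Ordinal ir)) -yf iter_shiftE addrC PoszD.
move=> h i _; rewrite /standard_partition preimage_shift_cylinder1/=.
move/(congr1 (fun w => nth ord0 w i)): h.
by rewrite nth_mkseq// nth_f iter_shiftE addrC PoszD.
Qed.

Section Measure.
Context {R : realType} (mu : probability X R).
Hypothesis mu_inv : shift_invariant mu.

Definition prob (w : seq T) : R := fine (mu (cylinder w)).

(** The sets on the right partition [B] according to the word read at
coordinates [a], ..., [a + n - 1]. *)
Lemma measure_partition_words (B : set X) a n : measurable B ->
  mu B = (\sum_(K <- words n) mu (B `&` iter a (@shift M) @^-1` cylinder K))%E.
Proof.
move=> mB; rewrite fsbig_seq; last exact: words_uniq.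
rewrite -measure_fin_bigcup.
- congr (mu _); apply/seteqP; split => [y By|y [K _ []]//].
  exists (initial_word (iter a (@shift M) y) n).
    by rewrite /= mem_words size_initial_word.
  by split => //; rewrite /cylinder/= size_initial_word.
- exact: finite_seq.
- move=> K L /=; rewrite !mem_words => /eqP sK /eqP sL [y [[_ /=]]].
  by rewrite /cylinder/= sK => <- [_ /=]; rewrite sL.
- move=> K _; apply: measurableI => //.
  exact: measurable_preimage_shift_cylinder.
Qed.

Lemma probE w : mu (cylinder w) = (prob w)%:E.
Proof. by rewrite fineK// fin_num_measure//; exact: measurable_cylinder. Qed.

Lemma measure_preimage_shift_cylinder a w :
  mu (iter a (@shift M) @^-1` cylinder w) = (prob w)%:E.
Proof.
elim: a => [|a IH]; first by rewrite -probE.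
rewrite -IH -[RHS]mu_inv; last exact: measurable_preimage_shift_cylinder.
by congr (mu _); apply/seteqP; split => y; rewrite /preimage/= -iterSr.
Qed.

Lemma prob_ge0 w : 0 <= prob w.
Proof. by rewrite fine_ge0. Qed.

Lemma prob_nil : prob [::] = 1.
Proof. by rewrite /prob cylinder_nil probability_setT. Qed.

Lemma prob_catr w n : \sum_(u <- words n) prob (w ++ u) = prob w.
Proof.
apply: EFin_inj; rewrite -probE -sumEFin.
rewrite (measure_partition_words (size w) n (measurable_cylinder w)).
by apply: eq_bigr => u _; rewrite -probE cylinder_cat.
Qed.

Lemma prob_catl w n : \sum_(u <- words n) prob (u ++ w) = prob w.
Proof.
apply: EFin_inj; rewrite -(measure_preimage_shift_cylinder n) -sumEFin.
rewrite (measure_partition_words 0 n (measurable_preimage_shift_cylinder n w)).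
rewrite !big_seq; apply: eq_bigr => u; rewrite mem_words => /eqP sn.
by rewrite -probE cylinder_cat sn setIC.
Qed.

Lemma measure_gap I J g :
  mu (cylinder I `&` iter (size I + g) (@shift M) @^-1` cylinder J) =
  (gap_prob (p := prob) g I J)%:E.
Proof.
rewrite (@measure_partition_words _ (size I) g); last first.
  apply: measurableI; first exact: measurable_cylinder.
  exact: measurable_preimage_shift_cylinder.
rewrite /gap_prob -sumEFin !big_seq; apply: eq_bigr => K.
rewrite mem_words => /eqP <-; rewrite -probE catA cylinder_cat cylinder_cat.
by rewrite setIAC size_cat.
Qed.

Lemma sum_words_ffun (V : nmodType) n (F : seq T -> V) :
  \sum_(f : {ffun 'I_n -> T}) F (codom f) = \sum_(w <- words n) F w.
Proof.
rewrite sum_words_tuple (reindex (fun t : n.-tuple T => [ffun i => tnth t i])).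
  apply: eq_bigr => t _; congr F; rewrite codomE -[RHS]map_tnth_enum.
  by apply: eq_map => i; rewrite ffunE.
exists (fun f : {ffun 'I_n -> T} => [tuple f i | i < n]) => [t _|f _].
  by apply: eq_from_tnth => i; rewrite tnth_mktuple ffunE.
by apply/ffunP => i; rewrite ffunE tnth_mktuple.
Qed.

Lemma weak_bernoulli_gap_prob :
  (forall eps : R, 0 < eps -> exists G, forall s g r, (G <= g)%N ->
    \sum_(I <- words s) \sum_(J <- words r)
      `|gap_prob (p := prob) g I J - prob I * prob J| < eps) ->
  weak_bernoulli mu.
Proof.
move=> h eps /h[G hG]; exists G => r s m /subnKC <-; move: (m - _)%N => k.
rewrite /eps_independent.
under eq_bigr do under eq_bigr do rewrite !iter_join_cylinder.
rewrite (sum_words_ffun _ (fun I => \sum_(j : {ffun 'I_r -> T})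
  `|mu (cylinder I `&` iter (s + G + k) (@shift M) @^-1` cylinder (codom j))
    - mu (cylinder I) * mu (iter (s + G + k) (@shift M) @^-1` cylinder (codom j))|)%E).
rewrite -addnA; have := hG s (G + k)%N r (leq_addr _ _).
rewrite -lte_fin; congr (_ < _)%E; rewrite -sumEFin !big_seq; apply: eq_bigr => I.
rewrite mem_words => /eqP sI; rewrite -sumEFin.
rewrite (sum_words_ffun _ (fun J =>
  `|mu (cylinder I `&` iter (s + (G + k)) (@shift M) @^-1` cylinder J)
    - mu (cylinder I) * mu (iter (s + (G + k)) (@shift M) @^-1` cylinder J)|)%E).
apply: eq_bigr => J _.
by rewrite -[in RHS]sI measure_gap probE measure_preimage_shift_cylinder.
Qed.

End Measure.
End Shift.

(** * Gibbs states *)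

Section Gibbs.
Context {R : realType} {d M : nat} {nrm : 'M[R]_d -> R} (hn : is_norm nrm).
Context {A : 'I_M.+1 -> 'M[R]_d} {t : R} (t_gt0 : 0 < t).
Context {mu : probability (borel_shift M) R}.
Local Notation T := 'I_M.+1.
Local Notation p := (prob mu).

Lemma word_mx_cat (u v : seq T) :
  word_mx A (u ++ v) = word_mx A u *m word_mx A v.
Proof. by rewrite /word_mx big_cat. Qed.

(** The quantity that a Gibbs state compares with the mass of the cylinder of
[w]. *)
Definition gibbs_weight (P : R) (w : seq T) :=
  expR (- ((size w)%:R * P)) * nrm (word_mx A w) `^ t.

Lemma gibbs_weight_ge0 P w : 0 <= gibbs_weight P w.
Proof. by rewrite mulr_ge0 ?expR_ge0 ?powR_ge0. Qed.

(** Every nonempty word is the initial word of some point, so the bounds, which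
are stated along points, hold for words. *)
Lemma gibbs_state_weight C P (w : seq T) : w != [::] ->
  (forall (x : full_shift M) (n : nat), (0 < n)%N ->
      let w := initial_word x n in
      let a := expR (- (n%:R * P)) * nrm (word_mx A w) `^ t in
      ((C^-1)%:E * mu (cylinder w) <= a%:E)%E /\
      (a%:E <= C%:E * mu (cylinder w))%E) ->
  C^-1 * p w <= gibbs_weight P w /\ gibbs_weight P w <= C * p w.
Proof.
move=> w0 h; have w_gt0 : (0 < size w)%N by rewrite lt0n size_eq0.
pose x : full_shift M := fun i : int => nth ord0 w `|i|%N.
have xw : initial_word x (size w) = w by exact: mkseq_nth.
by have := h x _ w_gt0; rewrite /= xw probE// -!EFinM !lee_fin.
Qed.

Lemma gibbs_weight_cat_le (kappa P : R) (u v : seq T) : 0 <= kappa ->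
  nrm (word_mx A u *m word_mx A v) <=
    kappa * (nrm (word_mx A u) * nrm (word_mx A v)) ->
  gibbs_weight P (u ++ v) <= kappa `^ t * (gibbs_weight P u * gibbs_weight P v).
Proof.
move=> k0 h; rewrite /gibbs_weight size_cat natrD mulrDl opprD expRD mulrACA.
rewrite [leRHS]mulrCA ler_wpM2l ?mulr_ge0 ?expR_ge0// word_mx_cat.
rewrite -!powRM ?mulr_ge0 ?is_norm_ge0//.
by apply: ge0_ler_powR; rewrite ?nnegrE ?mulr_ge0 ?is_norm_ge0// ltW.
Qed.

(** Pigeonhole: some term of the sum is at least the average. *)
Lemma primitive_exists N (delta : R) (I J : seq T) :
  delta * nrm (word_mx A I) * nrm (word_mx A J) <= \sum_(K : N.-tuple T)
     nrm (word_mx A I * word_mx A K * word_mx A J) ->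
  exists K : N.-tuple T, delta / #|{: N.-tuple T}|%:R *
    (nrm (word_mx A I) * nrm (word_mx A J)) <= nrm (word_mx A (I ++ K ++ J)).
Proof.
set D := #|_|; set x := (X in X <= _) => h.
have D_gt0 : (0 < D)%N by apply/card_gt0P; exists [tuple ord0 | _ < N].
apply: contrapT => nK; move: h; apply/negP; rewrite -ltNge.
have -> : x = \sum_(K : N.-tuple T) x / D%:R.
  by rewrite sumr_const -[RHS]mulr_natr divfK// pnatr_eq0 -lt0n.
apply: ltr_sum => [|K _]; first by apply/hasP; exists [tuple ord0 | _ < N];
  rewrite ?mem_index_enum.
rewrite ltNge; apply/negP => hK; apply: nK; exists K.
by rewrite !word_mx_cat mulmxA mulrAC mulrA.
Qed.

End Gibbs.

(** For gap [N] the single connecting word of [primitive_exists] carries enough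
mass; a longer gap is reduced to this one by summing over the extensions of [J]
to the left. The Gibbs bounds only concern nonempty words, but if [I] or [J] is
empty then [gap_prob] equals the product, whence the minimum with [1]. *)
Lemma gibbs_gap_lower (R : realType) (d M : nat) (nrm : 'M[R]_d -> R)
    (hn : is_norm nrm) (A : 'I_M.+1 -> 'M[R]_d) (hA : primitive nrm A)
    (t : R) (t_gt0 : 0 < t) (mu : probability (borel_shift M) R)
    (hmu : gibbs_state nrm A t mu) :
  exists2 c : R, 0 < c & exists N, forall g I J, (N <= g)%N ->
    c * (prob mu I * prob mu J) <= gap_prob (p := prob mu) g I J.
Proof.
case: hmu => mu_inv [C [P [C_gt0 hC]]].
case: hA => N [delta [delta_gt0 hN]].
set D := #|{: N.-tuple 'I_M.+1}|%:R : R.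
have D_gt0 : 0 < D.
  by rewrite ltr0n; apply/card_gt0P; exists [tuple ord0 | _ < N].
pose e := expR (- (N%:R * P)) * (delta / D) `^ t.
have e_gt0 : 0 < e by rewrite mulr_gt0 ?expR_gt0// powR_gt0// divr_gt0.
pose c0 := C^-1 * (e * (C^-1 * C^-1)).
have c0_gt0 : 0 < c0 by rewrite mulr_gt0 ?invr_gt0// mulr_gt0// mulr_gt0 ?invr_gt0.
pose c := Num.min 1 c0.
have c_gt0 : 0 < c by rewrite lt_min ltr01.
exists c => //; exists N.
have base I J : c * (prob mu I * prob mu J) <= gap_prob (p := prob mu) N I J.
  have pp_ge0 I' J' : 0 <= prob mu I' * prob mu J' by rewrite mulr_ge0 ?prob_ge0.
  have c_le1 x : 0 <= x -> c * x <= x.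
    by move=> x0; rewrite ler_piMl// ge_min lexx.
  have [->|I0] := eqVneq I [::].
    by rewrite prob_nil mul1r gap_prob_nill ?c_le1 ?prob_ge0// => *; exact: prob_catl.
  have [->|J0] := eqVneq J [::].
    by rewrite prob_nil mulr1 gap_prob_nil ?c_le1 ?prob_ge0// => *; exact: prob_catr.
  apply: (@le_trans _ _ (c0 * (prob mu I * prob mu J))).
    by rewrite ler_wpM2r// ge_min lexx orbT.
  have [K hK] := primitive_exists (hN I J).
  have IKJ0 : I ++ K ++ J != [::] by case: (I) I0.
  apply: (@le_trans _ _ (prob mu (I ++ K ++ J))); last first.
    rewrite /gap_prob sum_words_tuple (bigD1 K)//= lerDl.
    by apply: sumr_ge0 => ? _; exact: prob_ge0.
  have [_ wIKJ] := gibbs_state_weight IKJ0 hC.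
  have [wI _] := gibbs_state_weight I0 hC.
  have [wJ _] := gibbs_state_weight J0 hC.
  rewrite /c0 -mulrA ler_pdivrMl//; apply: le_trans wIKJ.
  rewrite -mulrA (mulrACA C^-1).
  apply: (@le_trans _ _ (e * (gibbs_weight (nrm := nrm) (A := A) (t := t) P I *
    gibbs_weight (nrm := nrm) (A := A) (t := t) P J))).
    rewrite ler_pM2l//; apply: ler_pM => //;
      by rewrite mulr_ge0 ?prob_ge0// invr_ge0 ltW.
  rewrite /gibbs_weight !size_cat size_tuple !natrD !mulrDl !opprD !expRD.
  set eI := expR _; set eJ := expR _; set eN := expR _.
  set nI := _ `^ t; set nJ := _ `^ t.
  rewrite (_ : e * _ = eI * (eN * eJ) * ((delta / D) `^ t * (nI * nJ))); last first.
    by rewrite /e -/eN; ring.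
  have n_ge0 w : 0 <= nrm (word_mx A w) by exact: is_norm_ge0.
  have dD_ge0 : 0 <= delta / D by rewrite divr_ge0// ltW.
  rewrite ler_wpM2l ?mulr_ge0 ?expR_ge0// -!powRM ?(mulr_ge0 (n_ge0 _) (n_ge0 _))//.
  have dDn_ge0 := mulr_ge0 dD_ge0 (mulr_ge0 (n_ge0 I) (n_ge0 J)).
  by apply: ge0_ler_powR; rewrite ?nnegrE//; exact: ltW.
move=> g I J /subnKC <-.
rewrite -gap_prob_extm -(prob_catl mu_inv J (g - N)) !mulr_sumr.
by apply: ler_sum => K _; exact: base.
Qed.

(** The weight of [I ++ K ++ J] is at most a constant times the product of the
three weights, and the masses of the words [K] of length [g] add up to [1]. The
maximum with [1] accounts for empty [I] or [J]; the gap is nonempty so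
that the Gibbs bounds apply to [K]. *)
Lemma gibbs_gap_upper (R : realType) (d M : nat) (nrm : 'M[R]_d -> R)
    (hn : is_norm nrm) (A : 'I_M.+1 -> 'M[R]_d)
    (t : R) (t_gt0 : 0 < t) (mu : probability (borel_shift M) R)
    (hmu : gibbs_state nrm A t mu) :
  exists C : R, forall g I J, (0 < g)%N ->
    gap_prob (p := prob mu) g I J <= C * (prob mu I * prob mu J).
Proof.
case: hmu => mu_inv [C [P [C_gt0 hC]]].
have [k k_gt0 hk] := mx_norm_submultiplicative hn.
pose k2 := k `^ t * k `^ t.
have k2_ge0 : 0 <= k2 by rewrite mulr_ge0 ?powR_ge0.
pose C0 := C * (k2 * (C * C * C)).
exists (Num.max 1 C0) => g I J g_gt0.
have pp_ge0 I' J' : 0 <= prob mu I' * prob mu J' by rewrite mulr_ge0 ?prob_ge0.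
have C_ge1 x : 0 <= x -> x <= Num.max 1 C0 * x.
  by move=> x0; rewrite ler_peMl// le_max lexx.
have [->|I0] := eqVneq I [::].
  by rewrite prob_nil mul1r gap_prob_nill ?C_ge1 ?prob_ge0// => *; exact: prob_catl.
have [->|J0] := eqVneq J [::].
  by rewrite prob_nil mulr1 gap_prob_nil ?C_ge1 ?prob_ge0// => *; exact: prob_catr.
apply: (@le_trans _ _ (C0 * (prob mu I * prob mu J))); last first.
  by rewrite ler_wpM2r// le_max lexx orbT.
rewrite -[leRHS]mulr1 -(p_total (@prob_nil _ _ mu) (prob_catr mu) g) mulr_sumr.
rewrite /gap_prob !big_seq; apply: ler_sum => K; rewrite mem_words => /eqP sK.
have K0 : K != [::] by rewrite -size_eq0 sK -lt0n.
have IKJ0 : I ++ K ++ J != [::] by case: (I) I0.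
pose w := gibbs_weight (nrm := nrm) (A := A) (t := t) P.
have [wIKJ _] := gibbs_state_weight IKJ0 hC.
have [_ wI] := gibbs_state_weight I0 hC.
have [_ wJ] := gibbs_state_weight J0 hC.
have [_ wK] := gibbs_state_weight K0 hC.
have w_ge0 v : 0 <= w v by exact: gibbs_weight_ge0.
rewrite ler_pdivrMl// -/(w _) in wIKJ; apply: le_trans wIKJ _.
rewrite /C0 -!mulrA ler_pM2l//.
have wcat u v : w (u ++ v) <= k `^ t * (w u * w v).
  by apply: gibbs_weight_cat_le; rewrite ?hk// ltW.
apply: (@le_trans _ _ (k `^ t * (w I * (k `^ t * (w K * w J))))).
  by apply: le_trans (wcat _ _) _; rewrite ler_wpM2l ?powR_ge0// ler_wpM2l.
rewrite (_ : k `^ t * _ = k2 * (w I * (w K * w J))); last by rewrite /k2; ring.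
rewrite [leRHS]mulrA -/k2 ler_wpM2l//.
apply: (@le_trans _ _ ((C * prob mu I) * ((C * prob mu K) * (C * prob mu J)))).
  apply: ler_pM; [exact: w_ge0|by rewrite mulr_ge0|exact: wI|].
  by apply: ler_pM; [exact: w_ge0|exact: w_ge0|exact: wK|exact: wJ].
by rewrite le_eqVlt; apply/orP; left; apply/eqP; ring.
Qed.

Theorem theorem1p3 (R : realType) (d M : nat) (nrm : 'M[R]_d -> R)
    (hnrm : is_norm nrm) (A : 'I_M.+1 -> 'M[R]_d) (hA : primitive nrm A)
    (t : R) (ht : 0 < t) (mu : probability (borel_shift M) R)
    (hmu : gibbs_state nrm A t mu) :
  weak_bernoulli mu.
Proof.
have [c c_gt0 [N lower]] := gibbs_gap_lower hnrm hA ht hmu.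
have [C upper] := gibbs_gap_upper hnrm ht hmu.
have [mu_inv _] := hmu.
apply: weak_bernoulli_gap_prob => // eps eps_gt0.
apply: (@gap_prob_weak_bernoulli R _ (prob mu) _ _ _ _ N.+1 c C) => //.
- exact: prob_ge0.
- exact: prob_nil.
- exact: prob_catr.
- exact: prob_catl.
- by move=> g I J Ng; apply: lower; exact: ltnW.
- by move=> g I J Ng; apply: upper; exact: leq_trans Ng.
Qed.
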